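(* Let $f:\bar{\mathbb C}\to\bar{\mathbb C}$ be a rational map. If $\deg f>1$, then $\mathcal R_f$ has no compact leaves.
   Context: $\mathcal N_f$ is the space of backward orbits $\hat z=(z_0,z_{-1},\dots)$, $f(z_{-(n+1)})=z_{-n}$, with the topology induced by the product topology; $\pi_{-n}(\hat z)=z_{-n}$. A point $\hat z$ is regular if there is a neighborhood $U$ of $z_0$ such that, with $U_{-n}$ the component of $f^{-n}(U)$ containing $z_{-n}$, the maps $f:U_{-(n+1)}\to U_{-n}$ are univalent for all sufficiently large $n$. $\mathcal R_f$ is the set of regular points. The leaves of $\mathcal R_f$ are its path-connected components; each carries an intrinsic topology, with basic neighborhoods $\hat U=\{\hat\zeta:\zeta_{-n}\in U_{-n}\ \forall n\}$ (where $\hat z$ is a point of the leaf, $U$ is a neighborhood of $z_0$, and $U_{-n}$ is the component of $f^{-n}(U)$ containing $z_{-n}$, with $f:U_{-(n+1)}\to U_{-n}$ univalent for all sufficiently large $n$), and a Riemann surface structure with charts $\pi_{-N}$, $N$ large. Compactness refers to the intrinsic topology. *)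

(* Defs.v *)
From HB Require Import structures.
From mathcomp Require Import all_boot all_order all_algebra complex.
From mathcomp Require Import all_classical all_reals all_analysis.

Set Implicit Arguments.
Unset Strict Implicit.
Unset Printing Implicit Defensive.

Import Order.TTheory GRing.Theory Num.Theory.
Import numFieldTopology.Exports.

Local Open Scope classical_set_scope.
Local Open Scope ring_scope.
Local Open Scope complex_scope.

(* [None] is the point at infinity. *)
Definition sphere (R : realType) : topologicalType :=
  one_point_compactification R[i]^o.

(* A quotient of two polynomials in lowest terms; [coprimep] excludes the pair
   (0, 0), and (1, 0) is the constant map with value infinity. *)
Record ratmap (R : realType) := Ratmap {
  rnum : {poly R[i]};
  rden : {poly R[i]};
  rnum_rden_coprime : coprimep rnum rden
}.

Definition ratmap_deg (R : realType) (f : ratmap R) : nat :=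
  (maxn (size (rnum f)) (size (rden f))).-1.

(* With d the degree, f(z) = z^d P(1/z) / z^d Q(1/z), where z^d P(1/z) and
   z^d Q(1/z) are polynomials in 1/z with constant coefficients P_d, Q_d; this
   gives the value at infinity. *)
Definition ratmap_fun (R : realType) (f : ratmap R) (z : sphere R) : sphere R :=
  let quot (a b : R[i]) : sphere R := if b == 0 then None else Some (a / b) in
  match z with
  | Some x => quot (rnum f).[x] (rden f).[x]
  | None => quot (rnum f)`_(ratmap_deg f) (rden f)`_(ratmap_deg f)
  end.

Coercion ratmap_fun : ratmap >-> Funclass.

(* The path component of [x] in the subset [A] of [T]. *)
Definition path_component (R : realType) (T : topologicalType)
    (A : set T) (x : T) : set T :=
  [set y | exists gamma : R -> T,
    [/\ {within `[0, 1], continuous gamma},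
        gamma 0 = x, gamma 1 = y &
        forall t : R, 0 <= t <= 1 -> A (gamma t)]].

Section natural_extension.
Context {R : realType} (f : ratmap R).

Definition backward_orbit : set {ptws nat -> sphere R} :=
  [set z | forall n, f (z n.+1) = z n].

(* The inverse limit N_f; [set_type] carries the topology induced by the
   product topology. The index [n] stands for [-n]. *)
Definition natural_ext : topologicalType := set_type backward_orbit.

Definition orbit_proj (n : nat) (z : natural_ext) : sphere R := set_val z n.

Definition pullback (U : set (sphere R)) (z : natural_ext) (n : nat) :
    set (sphere R) :=
  connected_component (iter n f @^-1` U) (orbit_proj n z).

(* Rational maps are holomorphic and map U_{-(n+1)} into U_{-n}, so univalence
   of the restriction is injectivity. *)
Definition eventually_univalent (U : set (sphere R)) (z : natural_ext) : Prop :=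
  \forall n \near \oo, set_inj (pullback U z n.+1) f.

Definition regular_nbhs (z : natural_ext) (U : set (sphere R)) : Prop :=
  open_nbhs (orbit_proj 0 z) U /\ eventually_univalent U z.

Definition regular_points : set natural_ext :=
  [set z | exists U, regular_nbhs z U].

Definition leaf (L : set natural_ext) : Prop :=
  exists2 z, regular_points z & L = path_component R regular_points z.

Definition orbit_box (U : set (sphere R)) (z : natural_ext) :
    set natural_ext :=
  [set w | forall n, pullback U z n (orbit_proj n w)].

(* The set of regular points with the intrinsic (leafwise) topology, as opposed
   to the topology induced by [natural_ext]. Each box is contained in a single
   leaf, so the leaves are open, and this topology restricts on each leaf to the
   intrinsic topology of that leaf. *)
Definition leaf_space : Type := set_type regular_points.

HB.instance Definition _ := Choice.on leaf_space.

Definition leaf_space_val (z : leaf_space) : natural_ext := set_val z.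

Definition leaf_nbhs (z : leaf_space) : set_system leaf_space :=
  filter_from (regular_nbhs (leaf_space_val z))
    (fun U => leaf_space_val @^-1` orbit_box U (leaf_space_val z)).

Lemma orbit_proj_iter (z : natural_ext) n :
  iter n f (orbit_proj n z) = orbit_proj 0 z.
Proof.
elim: n => [//|n IH]; rewrite iterSr.
suff -> : f (orbit_proj n.+1 z) = orbit_proj n z by [].
exact: (set_valP z).
Qed.

Lemma orbit_box_refl U z : U (orbit_proj 0 z) -> orbit_box U z z.
Proof.
by move=> Uz n; apply: connected_component_refl; rewrite /= orbit_proj_iter.
Qed.

Lemma pullbackS U V z n : U `<=` V -> U (orbit_proj 0 z) ->
  pullback U z n `<=` pullback V z n.
Proof.
move=> UV Uz; apply: connected_component_max.
- by apply: connected_component_refl; rewrite /= orbit_proj_iter.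
- by move=> x /connected_component_sub /UV.
- exact: component_connected.
Qed.

Lemma orbit_box_pullback U z w n :
  orbit_box U z w -> pullback U w n = pullback U z n.
Proof. by move=> /(_ n) /same_connected_component. Qed.

Let leaf_nbhs_filter z : ProperFilter (leaf_nbhs z).
Proof.
apply: filter_from_proper; last first.
  by move=> U [[_ Uz] _]; exists z; exact: orbit_box_refl.
apply: filter_from_filter.
  by have := set_valP z; rewrite /regular_points.
move=> U V [[oU Uz] uU] [[oV Vz] uV]; exists (U `&` V).
  split; first by split=> //; exact: openI.
  near=> n => x y.
  have sub : pullback (U `&` V) (leaf_space_val z) n.+1 `<=`
             pullback U (leaf_space_val z) n.+1.
    by apply: pullbackS => // ? [].
  move=> /set_mem/sub/mem_set xU /set_mem/sub/mem_set yU.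
  by apply: (near uU n).
by move=> w wB; split=> n; move: (wB n); apply: pullbackS => // ? [].
Unshelve. all: by end_near. Qed.

Let leaf_nbhs_singleton z A : leaf_nbhs z A -> A z.
Proof. by case=> U [[_ Uz] _]; apply; exact: orbit_box_refl. Qed.

Let leaf_nbhs_nbhs z A : leaf_nbhs z A -> leaf_nbhs z (leaf_nbhs^~ A).
Proof.
case=> U [[oU Uz] uU] UA; exists U => // w wU.
have e n : pullback U (leaf_space_val w) n = pullback U (leaf_space_val z) n.
  exact: orbit_box_pullback.
exists U; first split.
- split=> //; have /connected_component_sub := wU 0; exact.
- by apply: filterS uU => n; rewrite e.
- by move=> v vU; apply: UA => n; rewrite -e; exact: vU.
Qed.

HB.instance Definition _ := hasNbhs.Build leaf_space leaf_nbhs.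
HB.instance Definition _ := Nbhs_isNbhsTopological.Build leaf_space
  leaf_nbhs_filter leaf_nbhs_singleton leaf_nbhs_nbhs.

Lemma nbhs_leaf_spaceE (z : leaf_space) : nbhs z = leaf_nbhs z.
Proof. by []. Qed.

End natural_extension.

(* Main.v *)
Require Import Defs.
From mathcomp Require Import all_boot all_order all_algebra complex lra.
From mathcomp Require Import all_classical all_reals all_analysis.

(** Let [L] be a compact leaf and write [pi_n] for [orbit_proj n] restricted
    to [L].  Classically, every [pi_n] would be a branched covering of the
    sphere of some finite degree, and [pi_0 = f^n o pi_n] would give
    [deg pi_0 = (deg f)^n * deg pi_n] for all [n], which is absurd when
    [deg f > 1].  The proof below runs this argument with the number of
    points of fibres in place of degrees.

    Each [pi_n] is onto ([leaf_proj_surj]).  Its image is open, because a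
    point of the sphere close to the [n]-th coordinate of some [z] in [L] can
    be reached by a path, and this path lifts to a path of backward orbits
    issued from [z] ([lift_path]): far back in the orbit, [f] maps each
    pullback homeomorphically onto the preceding one.  Its image is closed,
    because [pi_n] is continuous for the intrinsic topology
    ([orbit_proj_leaf_continuous]): pullbacks of small neighbourhoods are
    small, as fibres of iterates of [f] are finite ([pullback_shrink]).  The
    sphere is connected, so the image is everything.

    The fibres of [pi_M] are bounded for some [M] ([compact_leaf_fiber]).
    Finitely many boxes cover [L], and [pi_M] is injective on each of them as
    soon as [M] exceeds the index from which all the pullbacks are univalent.
    So a fibre of [pi_M] has at most as many points as there are boxes, say
    [k].

    As [pi_(k + M)] is onto and [pi_M = f^k o pi_(k + M)], the fibre of [pi_M]
    over [p] has at least as many points as the fibre of [f^k] over [p].  For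
    all but finitely many [p] the latter has at least [2^k > k] points
    ([many_iterated_preimages]), because all but finitely many points of the
    sphere have two distinct preimages: two equal roots of [P - c Q] force a
    zero of the Wronskian [P' Q - P Q'].

    All this rests on rational maps being continuous, open and finite to one.
    Openness is the least elementary of the three: it comes from an explicit
    estimate which locates a root of a polynomial close to a point where the
    polynomial is small compared with its value elsewhere ([root_near]). *)

Set Implicit Arguments.
Unset Strict Implicit.
Unset Printing Implicit Defensive.

Import Order.TTheory GRing.Theory Num.Theory.
Import numFieldNormedType.Exports.

Local Open Scope classical_set_scope.
Local Open Scope ring_scope.

(** * Polynomials over an algebraically closed field *)

(** If every root [z] stays at distance at least [r] from [a], then each factor
    of [p.[b]] satisfies [`|b - z| <= `|a - z| * (1 + `|b - a| / r)], hence
    [p.[b]] is bounded by [p.[a]] times the [d]-th power of the constant.  The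
    bound involves no coefficient of [p], so that it stays uniform in a family
    of polynomials whose leading coefficient tends to [0]. *)
Lemma root_near (C : numClosedFieldType) (p : {poly C}) (d : nat) (a b r : C) :
  (size p <= d.+1)%N -> 0 < r ->
  `|p.[a]| * (1 + `|b - a| / r) ^+ d < `|p.[b]| ->
  exists2 x, root p x & `|x - a| < r.
Proof.
move=> sp r0 pab; have [s pE] := closed_field_poly_normal p.
have p0 : p != 0.
  by apply: contraTneq pab => ->; rewrite !horner0 normr0 mul0r ltxx.
have rootE x : root p x = (x \in s).
  by rewrite pE rootZ ?lead_coef_eq0// root_prod_XsubC.
have [/hasP[x xs xa]|/hasPn far] := boolP (has (fun x => `|x - a| < r) s).
  by exists x => //; rewrite rootE.
have K1 : 1 <= 1 + `|b - a| / r.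
  by rewrite lerDl divr_ge0// ltW.
have sE : (size s <= d)%N.
  rewrite -ltnS; apply: leq_trans sp; rewrite pE size_scale ?lead_coef_eq0//.
  by rewrite size_prod_XsubC.
suff : `|p.[b]| <= `|p.[a]| * (1 + `|b - a| / r) ^+ d.
  by move=> /(lt_le_trans pab); rewrite ltxx.
apply: (@le_trans _ _ (`|p.[a]| * (1 + `|b - a| / r) ^+ size s)); last first.
  by rewrite ler_wpM2l// ler_weXn2l.
rewrite pE !hornerZ !normrM -mulrA ler_wpM2l// => {sp sE pE rootE p0 pab}.
elim: s far => [|x s IH] far; first by rewrite !big_nil !hornerE.
rewrite !big_cons !hornerM !normrM !hornerXsubC exprS mulrACA.
apply: ler_pM => //; last first.
  by apply: IH => y ys; apply: far; rewrite inE ys orbT.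
have rx : r <= `|a - x|.
  have := far x (mem_head _ _); rewrite distrC -real_leNgt ?normr_real//.
  by rewrite realE (ltW r0).
have -> : b - x = (a - x) + (b - a) by rewrite [RHS]addrC addrA subrK.
apply: le_trans (ler_normD _ _) _; rewrite mulrDr mulr1 lerD2l.
by rewrite mulrC -mulrA ler_peMr// ler_pdivlMl// mulr1.
Qed.

(** For degree reasons the derivative vanishes, and the characteristic is
    zero. *)
Lemma deriv_dvdp_self (C : numFieldType) (p : {poly C}) :
  p %| p^`() -> (size p <= 1)%N.
Proof.
move=> pdvd; apply: contraT; rewrite -ltnNge => sp.
have p0 : p != 0 by rewrite -size_poly_gt0 ltnW.
have p'0 : p^`() != 0.
  apply: contraTneq sp => p'0; move: p0; rewrite -lead_coef_eq0 /lead_coef.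
  have := coef_deriv p (size p).-2; rewrite p'0 coef0.
  case: (size p) => [//|[//|n]] /= /esym/eqP.
  by rewrite mulrn_eq0 /= => /eqP->; rewrite eqxx.
by have := dvdp_leq p'0 pdvd; rewrite leqNgt lt_size_deriv.
Qed.

(** If [p' q = p q'] with [p] and [q] coprime, then [p] divides [p'] and [q]
    divides [q'], so both are constant. *)
Lemma wronskian_neq0 (C : numFieldType) (p q : {poly C}) :
  coprimep p q -> (1 < maxn (size p) (size q))%N ->
  p^`() * q - p * q^`() != 0.
Proof.
move=> pq; apply: contraTneq => /subr0_eq W.
rewrite -leqNgt geq_max; apply/andP; split; apply: deriv_dvdp_self.
  by rewrite -(Gauss_dvdpl _ pq) W dvdp_mulr.
by rewrite coprimep_sym in pq; rewrite -(Gauss_dvdpr _ pq) -W dvdp_mull.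
Qed.

(** The fibre over [c] of the rational function [p / q] consists of the roots of
    [p - c q].  The excluded values are the value at infinity, for which the
    degree of [p - c q] drops, and the critical values: a double root is a
    zero of the Wronskian. *)
Lemma pencil_two_roots (C : numClosedFieldType) (p q : {poly C}) :
  coprimep p q -> (2 < maxn (size p) (size q))%N ->
  exists B : seq C, forall c, c \notin B ->
    exists x y, [/\ x != y, root (p - c *: q) x & root (p - c *: q) y].
Proof.
move=> pq; set d := (maxn _ _) => d2.
have [r rE] := closed_field_poly_normal (p^`() * q - p * q^`()).
have W0 : p^`() * q - p * q^`() != 0 by rewrite wronskian_neq0// ltnW.
exists (p`_d.-1 / q`_d.-1 :: [seq p.[x] / q.[x] | x <- r]) => c.
rewrite inE negb_or => /andP[c1 c2].
have dK : d.-1.+1 = d by rewrite prednK// (ltn_trans _ d2).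
have lc : (p - c *: q)`_d.-1 != 0.
  rewrite coefB coefZ; have [q0|q0] := eqVneq q`_d.-1 0.
    rewrite q0 mulr0 subr0; apply/eqP => p0.
    have : (maxn (size p) (size q) <= d.-1)%N.
      rewrite geq_max; apply/andP; split; apply/leq_sizeP => j.
      - rewrite leq_eqVlt => /predU1P[<-//|]; rewrite dK => dj.
        by apply: nth_default; apply: leq_trans dj; rewrite leq_maxl.
      - rewrite leq_eqVlt => /predU1P[<-//|]; rewrite dK => dj.
        by apply: nth_default; apply: leq_trans dj; rewrite leq_maxr.
    by rewrite -/d -ltnS dK ltnn.
  by apply: contra_neq c1 => /subr0_eq ->; rewrite mulfK.
have sz : size (p - c *: q) = d.
  apply/eqP; rewrite eqn_leq; apply/andP; split.
    apply/leq_sizeP => j dj; rewrite coefB coefZ !nth_default ?mulr0 ?subr0//.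
      by apply: leq_trans dj; rewrite leq_maxr.
    by apply: leq_trans dj; rewrite leq_maxl.
  rewrite -dK ltnNge; apply: contra lc => /leq_sizeP->//.
have G0 : p - c *: q != 0 by apply: contraNneq lc => ->; rewrite coef0.
have [s sE] := closed_field_poly_normal (p - c *: q).
have : (2 <= size s)%N.
  move: d2; rewrite -sz sE size_scale ?lead_coef_eq0//.
  by rewrite size_prod_XsubC.
have rootE x : root (p - c *: q) x = (x \in s).
  by rewrite sE rootZ ?lead_coef_eq0// root_prod_XsubC.
case: s sE rootE => [//|x [//|y s]] sE rootE _.
exists x, y; rewrite !rootE !inE !eqxx !orbT; split => //.
apply: contra c2 => /eqP xy; move: sE; rewrite -{y}xy in rootE *.
rewrite !big_cons => sE.
have xG : root (p - c *: q) x by rewrite rootE mem_head.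
have px : p.[x] = c * q.[x].
  by move/rootP: xG => /eqP; rewrite !hornerE subr_eq0 => /eqP.
have p'x : p^`().[x] = c * q^`().[x].
  apply/eqP; rewrite -subr_eq0 -hornerZ -hornerN -hornerD -derivZ -derivB sE.
  by rewrite derivZ derivM derivXsubC !hornerE subrr !(mul0r, mulr0, addr0).
(* The double root [x] has the excluded value [c = p.[x] / q.[x]]. *)
have qx : q.[x] != 0.
  apply/eqP => qx; have := coprimep_root pq (x := x).
  by rewrite /root px qx mulr0 eqxx => /(_ isT).
apply/mapP; exists x; last by rewrite px mulfK.
rewrite -root_prod_XsubC -(@rootZ _ _ (lead_coef (p^`() * q - p * q^`())))
  ?lead_coef_eq0//.
by rewrite -rE /root !hornerE p'x px mulrAC subrr.
Qed.

(** * The complex plane *)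

Local Open Scope complex_scope.

Lemma continuous_poly (K : numFieldType) (p : {poly K}) :
  continuous (horner p : K^o -> K^o).
Proof.
elim/poly_ind: p => [|p c IH] x.
  have -> : horner (0 : {poly K}) = fun=> 0 by apply/funext => y; rewrite horner0.
  exact: cst_continuous.
have -> : horner (p * 'X + c%:P) = (fun y => p.[y] * y) \+ fun=> c.
  by apply/funext => y; rewrite hornerMXaddC.
apply: (@continuousD K K^o K^o); last exact: cst_continuous.
by apply: (@continuousM K K^o (horner p) id); [exact: IH|exact: id].
Qed.

Section complex_plane.
Context {R : realType}.
Local Notation C := R[i]^o.

Lemma real_complex_continuous : continuous (fun x : R => x%:C : C).
Proof.
move=> x A /nbhs_ballP[e e0 eA]; apply/nbhs_ballP.
have eE : e = (complex.Re e)%:C by rewrite RRe_real// realE ltW.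
have e1 : 0 < complex.Re e by move: e0; rewrite /= {1}eE ltcR.
exists (complex.Re e) => // y /=; rewrite -ball_normE /= => xy.
apply: eA; rewrite -ball_normE /= -rmorphB/= eE normc_def/= expr0n addr0.
by rewrite sqrtr_sqr ltcR.
Qed.

Lemma normc_ge_Im (z : R[i]) : `|complex.Im z|%:C <= `|z|.
Proof.
have := normc_ge_Re (z * 'i%C); rewrite ReiNIm normrN normrM.
by rewrite complexiE normCi mulr1.
Qed.

(** Heine-Borel for squares, which are products of two real segments; other
    bounded sets are compared with squares. *)
Lemma complex_square_compact (r : R) :
  compact [set z : C | `|complex.Re z| <= r /\ `|complex.Im z| <= r].
Proof.
have -> : [set z : C | `|complex.Re z| <= r /\ `|complex.Im z| <= r] =
    (fun u : R * R => (u.1%:C : C) + 'i%C * (u.2%:C : C)) @`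
      (`[-r, r] `*` `[-r, r]).
  apply/seteqP; split => [z /= [zr zi]|_ [[a b] /= [ar br] <-]].
    exists (complex.Re z, complex.Im z); last by rewrite -complexE.
    by rewrite /= !in_itv/= -!ler_norml.
  by rewrite /= !(mul0r, mul1r, add0r, addr0, subr0) !ler_norml; move: ar br;
    rewrite !in_itv.
apply: continuous_compact; last exact/compact_setX/segment_compact/segment_compact.
apply: continuous_subspaceT => u.
apply: (@continuousD _ C _ (fun u : R * R => u.1%:C : C)
  (fun u => 'i%C * (u.2%:C : C))).
  apply: (@continuous_comp _ _ _ fst (fun x : R => x%:C : C)); first exact: cvg_fst.
  exact: real_complex_continuous.
apply: (@continuousM R[i] _ (fun=> 'i%C : C) (fun u : R * R => u.2%:C : C));
  first exact: cst_continuous.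
apply: (@continuous_comp _ _ _ snd (fun x : R => x%:C : C)); first exact: cvg_snd.
exact: real_complex_continuous.
Qed.

Lemma complex_hausdorff : hausdorff_space C.
Proof. exact: norm_hausdorff. Qed.

Lemma complex_locally_compact : locally_compact [set: C].
Proof.
move=> x _; rewrite withinET.
pose K := [set z : C | `|complex.Re z| <= complex.Re (`|x| + 1) /\
                       `|complex.Im z| <= complex.Re (`|x| + 1)].
have cK : compact K by exact: complex_square_compact.
exists K; last by split=> //; exact: compact_closed complex_hausdorff cK.
apply/nbhs_ballP; exists 1 => //= y; rewrite -ball_normE/= => xy.
have yx : `|y| <= (complex.Re (`|x| + 1))%:C.
  rewrite RRe_real ?rpredD ?rpred1 ?normr_real// -(subrK x y) addrC.
  by rewrite (le_trans (ler_normD _ _))// lerD2l distrC ltW.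
by split; rewrite -lecR (le_trans _ yx)// ?normc_ge_Re ?normc_ge_Im.
Qed.

(** Cover the compact set by the discs of radius [n.+1]. *)
Lemma complex_compact_bounded (K : set C) : compact K ->
  exists2 M : R[i], 0 < M & forall z, K z -> `|z| < M.
Proof.
move=> /compact_near_coveringP/(_ nat \oo (fun n z => `|z| < n.+1%:R)) [].
  move=> z _; pose k := Num.truncn (complex.Re (`|z| + 1)).
  have zk : `|z| + 1 < k.+1%:R.
    rewrite -(@RRe_real _ (`|z| + 1)) ?rpredD ?rpred1 ?normr_real//.
    by rewrite -(rmorph_nat (real_complex R)) ltcR truncnS_gt.
  exists (ball z 1, [set n | (k <= n)%N]).
    by split; [exact: nbhsx_ballx|exact: nbhs_infty_ge].
  move=> [y n]/= []; rewrite -ball_normE/= => yz kn.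
  rewrite -(subrK z y) addrC (le_lt_trans (ler_normD _ _))//.
  apply: (@lt_le_trans _ _ k.+1%:R); last by rewrite ler_nat.
  by apply: lt_trans zk; rewrite ltrD2l distrC.
by move=> n _ Kn; exists n.+1%:R => // z; apply: (Kn n) => /=.
Qed.

End complex_plane.

(** * The Riemann sphere *)

Section sphere.
Context {R : realType}.
Local Notation C := R[i]^o.
Local Notation S := (sphere R).

Lemma sphere_compact : compact [set: S].
Proof. exact: one_point_compactification_compact. Qed.

Lemma sphere_hausdorff : hausdorff_space S.
Proof.
apply: one_point_compactification_hausdorff.
  exact: complex_locally_compact.
exact: complex_hausdorff.
Qed.

(** The neighbourhoods of infinity, defined as complements of compact sets, are
    the sets which contain the outside of a disc. *)
Lemma nbhs_infinityP (V : set S) : nbhs (None : S) V <->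
  V None /\ exists2 M : R[i], 0 < M & forall z : R[i], M < `|z| -> V (Some z).
Proof.
split=> [[K [cK _] KV]|[V0 [M M0 MV]]].
  split; first by apply: KV; right.
  have [M M0 KM] := complex_compact_bounded cK; exists M => // z zM.
  by apply: KV; left; exists z => // /KM /(lt_trans zM); rewrite ltxx.
pose K := [set z : C | `|complex.Re z| <= complex.Re (2 * M) /\
                       `|complex.Im z| <= complex.Re (2 * M)].
have cK : compact K by exact: complex_square_compact.
exists K; first by split => //; exact: compact_closed complex_hausdorff cK.
move=> _ [[z nKz <-]|->//]; apply: MV.
have Mr : M \is Num.real by rewrite realE ltW.
rewrite real_ltNge ?normr_real//; apply/negP => zM; apply: nKz.
have zM2 : `|z| <= (complex.Re (2 * M))%:C.
  rewrite RRe_real ?rpredM ?realn// (le_trans zM)// ler_peMl ?(ltW M0)//.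
  by rewrite ler1n.
by split; rewrite -lecR (le_trans _ zM2)// ?normc_ge_Re ?normc_ge_Im.
Qed.

Lemma nbhs_finiteP (a : R[i]) (V : set S) : nbhs (Some a : S) V <->
  exists2 e : R[i], 0 < e & forall z : R[i], `|z - a| < e -> V (Some z).
Proof.
split=> [/nbhs_ballP[e e0 eV]|[e e0 eV]].
  by exists e => // z za; apply: eV; rewrite -ball_normE/= distrC.
apply/nbhs_ballP; exists e => // z; rewrite -ball_normE/= distrC.
exact: eV.
Qed.

(** The involution [z |-> 1 / z].  It exchanges [0] and infinity, and reduces
    statements at infinity to statements at finite points. *)
Definition sphere_inv (x : S) : S :=
  if x is Some z then (if z == 0 then None else Some z^-1) else Some 0.

Lemma sphere_invK : involutive sphere_inv.
Proof.
by case=> [z|] /=; [case: (eqVneq z 0) => [->//|z0]|];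
  rewrite /= ?eqxx// invr_eq0 (negPf z0) invrK.
Qed.

Lemma sphere_inv_continuous : continuous sphere_inv.
Proof.
move=> [a|]; last first.
  move=> V /nbhs_finiteP[e e0 eV]; apply/nbhs_infinityP; split=> /=.
    by apply: eV; rewrite subrr normr0.
  exists e^-1; first by rewrite invr_gt0.
  move=> z ez; have z0 : 0 < `|z| by rewrite (lt_trans _ ez)// invr_gt0.
  have zn0 : z != 0 by rewrite -normr_gt0.
  rewrite /= (negPf zn0); apply: eV.
  by rewrite subr0 normrV ?unitfE// -(invrK e) ltf_pV2// posrE invr_gt0.
have [->|a0] := eqVneq a 0.
  rewrite /continuous_at /= eqxx => V /nbhs_infinityP[V0 [M M0 MV]].
  apply/nbhs_finiteP; exists M^-1; first by rewrite invr_gt0.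
  move=> z; rewrite subr0 => zM /=; case: eqVneq => // z0; apply: MV.
  by rewrite normrV ?unitfE// -(invrK M) ltf_pV2// posrE ?invr_gt0// normr_gt0.
have near0 : \forall z \near (a : C), Some (z^-1) = sphere_inv (Some z).
  apply/nbhs_ballP; exists `|a|; first by rewrite /= normr_gt0.
  move=> z; rewrite -ball_normE/= => za; case: eqVneq za => // ->.
  by rewrite subr0 ltxx.
move=> V VV.
have nearV : \forall z \near (a : C), V (Some (z^-1)).
  move: VV; rewrite /= (negPf a0) => VV.
  have ic : {for a, continuous (fun z : C => z^-1 : C)}.
    exact: (@inv_continuous R[i]).
  exact: (ic (Some @^-1` V) VV).
by apply: filterS2 near0 nearV => z /= <-.
Qed.

Lemma nbhs_sphere_inv (x : S) (V : set S) :
  nbhs (sphere_inv x) (sphere_inv @` V) -> nbhs x V.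
Proof.
move=> xV; have {}xV : nbhs x (sphere_inv @^-1` (sphere_inv @` V)).
  exact: sphere_inv_continuous.
apply: filterS xV => y [z Vz].
by move/(can_inj sphere_invK) <-.
Qed.

(** The retraction of the line onto [0, 1].  It makes segments into paths
    defined on the whole line, whose continuity needs no subspace topology. *)
Definition clamp (t : R) : R := (`|t| - `|t - 1| + 1) / 2.

Lemma clamp_continuous : continuous clamp.
Proof.
move=> t; apply: cvgM; last exact: cvg_cst.
apply: cvgD; last exact: cvg_cst.
apply: cvgB; first exact: norm_continuous.
apply: cvg_norm; apply: cvgB; [exact: cvg_id|exact: cvg_cst].
Qed.

Lemma clamp0 : clamp 0 = 0.
Proof. by rewrite /clamp normr0 !sub0r normrN normr1 addNr mul0r. Qed.

Lemma clamp1 : clamp 1 = 1.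
Proof. by rewrite /clamp subrr normr0 normr1 subr0 divff. Qed.

Lemma clamp_itv t : 0 <= clamp t <= 1.
Proof.
rewrite /clamp; have [t0|t0] := ger0P t; have [t1|t1] := ger0P (t - 1);
  by apply/andP; split; lra.
Qed.

Lemma segment_path_continuous (a b : R[i]) :
  continuous (fun t : R => Some (a + (clamp t)%:C * (b - a)) : S).
Proof.
move=> t; apply: (@continuous_comp R C S
  (fun t : R => a + (clamp t)%:C * (b - a)) Some); last first.
  exact: one_point_compactification_some_continuous.
apply: (@continuousD _ C _ (fun=> a) (fun t : R => (clamp t)%:C * (b - a))).
  exact: cst_continuous.
apply: (@continuousM R[i] _ (fun t : R => (clamp t)%:C : C) (fun=> b - a)).
  apply: (@continuous_comp R R C clamp (fun x => x%:C : C)).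
    exact: clamp_continuous.
  exact: real_complex_continuous.
exact: cst_continuous.
Qed.

(** At a finite point, take segments in a disc; at infinity, the images of such
    segments by the inversion. *)
Lemma small_paths (x : S) (V : set S) : nbhs x V ->
  exists2 W, nbhs x W & forall y, W y -> exists gamma : R -> S,
    [/\ continuous gamma, gamma 0 = x, gamma 1 = y & forall t, V (gamma t)].
Proof.
have fin (a : R[i]) U : nbhs (Some a : S) U ->
    exists2 W, nbhs (Some a : S) W & forall y, W y -> exists gamma : R -> S,
    [/\ continuous gamma, gamma 0 = Some a, gamma 1 = y & forall t, U (gamma t)].
  move=> /nbhs_finiteP[e e0 eU].
  exists (Some @` [set z : R[i] | `|z - a| < e]).
    by apply/nbhs_finiteP; exists e => // z za; exists z.
  move=> _ [b ba <-]; exists (fun t : R => Some (a + (clamp t)%:C * (b - a))).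
  split; first exact: segment_path_continuous.
  - by rewrite clamp0 mul0r addr0.
  - by rewrite clamp1 mul1r addrC subrK.
  move=> t; apply: eU; rewrite addrC addKr normrM; apply: le_lt_trans ba.
  have /andP[t0 t1] := clamp_itv t.
  by rewrite ger0_norm ?ler0c// ler_piMl// -(rmorph1 (real_complex R)) lecR.
case: x => [a|]; first exact: fin.
move=> VV; have [|W W0 WP] := fin 0 (sphere_inv @^-1` V).
  by apply: (@sphere_inv_continuous (Some 0)); rewrite /= eqxx.
exists (sphere_inv @^-1` W).
  exact: (@sphere_inv_continuous None).
move=> y /WP[g [gc g0 g1 gV]]; exists (sphere_inv \o g); split.
- by move=> t; apply: continuous_comp; [exact: gc|exact: sphere_inv_continuous].
- by rewrite /= g0 /= eqxx.
- by rewrite /= g1 sphere_invK.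
- exact: gV.
Qed.

(** The base point [1] is fixed by the inversion, which turns the segment from
    [1] to [0] into a path from [1] to infinity. *)
Lemma sphere_path (y : S) : exists gamma : R -> S,
  [/\ continuous gamma, gamma 0 = Some 1 & gamma 1 = y].
Proof.
have seg b : exists gamma : R -> S,
    [/\ continuous gamma, gamma 0 = Some 1 & gamma 1 = Some b].
  exists (fun t : R => Some (1 + (clamp t)%:C * (b - 1))); split.
  - exact: segment_path_continuous.
  - by rewrite clamp0 mul0r addr0.
  - by rewrite clamp1 mul1r addrC subrK.
case: y => [b|//]; first exact: seg.
have [g [gc g0 g1]] := seg 0; exists (sphere_inv \o g); split.
- by move=> t; apply: continuous_comp; [exact: gc|exact: sphere_inv_continuous].
- by rewrite /= g0 /= oner_eq0 invr1.
- by rewrite /= g1 /= eqxx.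
Qed.

Lemma sphere_connected : connected [set: S].
Proof.
have [g gP] := choice sphere_path.
have -> : [set: S] = \bigcup_(y in [set: S]) range (g y).
  by apply/seteqP; split=> // y _; exists y => //; exists 1 => //; case: (gP y).
apply: bigcup_connected.
  by exists (Some 1 : S) => y _; exists 0 => //; case: (gP y).
move=> y _; apply: connected_continuous_connected.
  by apply/connected_intervalP => u v _ _ z _.
by apply: continuous_subspaceT; case: (gP y).
Qed.

Lemma connected_component_open (U : set S) x : open U ->
  open (connected_component U x).
Proof.
move=> oU; rewrite openE => y xy; have Uy := connected_component_sub xy.
have [W Wy WP] := small_paths (open_nbhs_nbhs (conj oU Uy)).
apply: filterS Wy => z /WP[g [gc g0 g1 gU]].
apply: (connected_component_trans xy).
exists (range g); last by exists 1.
split; [by exists 0|by move=> _ [t _ <-]|].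
apply: connected_continuous_connected.
  by apply/connected_intervalP => u v _ _ w _.
exact: continuous_subspaceT.
Qed.

End sphere.

(** * Rational maps of the sphere *)

(** The polynomial [x^d p(1/x)], for [p] of degree at most [d]. *)
Definition rev_poly (K : nzRingType) (d : nat) (p : {poly K}) : {poly K} :=
  \poly_(i < d.+1) p`_(d - i).

Lemma rev_poly_coefd (K : nzRingType) d (p : {poly K}) :
  (rev_poly d p)`_d = p.[0].
Proof. by rewrite coef_poly ltnSn subnn horner_coef0. Qed.

Lemma rev_poly_horner0 (K : nzRingType) d (p : {poly K}) :
  (rev_poly d p).[0] = p`_d.
Proof. by rewrite horner_coef0 coef_poly subn0. Qed.

Lemma rev_poly_horner (K : fieldType) d (p : {poly K}) x :
  (size p <= d.+1)%N -> x != 0 -> (rev_poly d p).[x] = x ^+ d * p.[x^-1].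
Proof.
move=> sp x0; rewrite horner_poly (horner_coef_wide _ sp) big_distrr/=.
rewrite (reindex_inj rev_ord_inj)/=; apply: eq_bigr => i _.
rewrite subSS subKn ?leq_ord// mulrCA; congr (_ * _).
by rewrite exprVn expfB_cond ?(negPf x0) ?leq_ord.
Qed.

Lemma poly_nonroot (K : numFieldType) (p : {poly K}) :
  p != 0 -> exists b, p.[b] != 0.
Proof.
move=> p0; apply: contrapT => nb.
have := @max_poly_roots K p [seq i%:R | i <- iota 0 (size p)] p0.
rewrite size_map size_iota ltnn => H; suff : false by []; apply: H.
  by apply/allP => x _; apply: contra_notT nb => px; exists x.
by rewrite map_inj_uniq ?iota_uniq// => i j /eqP; rewrite eqr_nat => /eqP.
Qed.

Section pencil.
Context {R : realType}.
Local Notation C := R[i]^o.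
Local Notation S := (sphere R).
Implicit Types (p q : {poly R[i]}) (d : nat).

(** The point [a : b] of the projective line. *)
Definition point_of_ratio (a b : R[i]) : S :=
  if b == 0 then None else Some (a / b).

Lemma point_of_ratio_inv a b : (a == 0) && (b == 0) = false ->
  point_of_ratio b a = sphere_inv (point_of_ratio a b).
Proof.
rewrite /point_of_ratio; case: (eqVneq a 0) => [->|a0] /=.
  by move=> -> /=; rewrite mul0r eqxx.
move=> _; have [->|b0] := eqVneq b 0; first by rewrite mul0r.
by rewrite /= mulf_eq0 invr_eq0 (negPf a0) (negPf b0) /= invf_div.
Qed.

Lemma point_of_ratio_scale c a b : c != 0 ->
  point_of_ratio (c * a) (c * b) = point_of_ratio a b.
Proof.
move=> c0; rewrite /point_of_ratio mulf_eq0 (negPf c0) /=.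
by case: eqVneq => // b0; rewrite -mulf_div divff// mul1r.
Qed.

(** The degree [d] is a parameter of its own, so that these maps are visibly
    stable under inversion at the target (exchange [p] and [q]) and at the
    source (reverse [p] and [q]). *)
Definition pencil_map d p q (z : S) : S :=
  if z is Some x then point_of_ratio p.[x] q.[x]
  else point_of_ratio p`_d q`_d.

(** Viewed as binary forms of degree [d], the polynomials [p] and [q] have no
    common zero on the projective line; the last condition is the one at
    infinity. *)
Definition pencil d p q :=
  [/\ (size p <= d.+1)%N, (size q <= d.+1)%N,
      forall x, root p x && root q x = false &
      (p`_d == 0) && (q`_d == 0) = false].

Lemma pencil_swap d p q : pencil d p q -> pencil d q p.
Proof. by case=> sp sq pq pqd; split=> // *; rewrite andbC. Qed.

Lemma pencil_map_swap d p q z : pencil d p q ->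
  pencil_map d q p z = sphere_inv (pencil_map d p q z).
Proof.
case=> _ _ pq pqd; case: z => [z|] /=; apply: point_of_ratio_inv => //.
exact: pq.
Qed.

Lemma pencil_rev d p q : pencil d p q -> pencil d (rev_poly d p) (rev_poly d q).
Proof.
case=> sp sq pq pqd; split; rewrite ?size_poly// ?rev_poly_coefd//; last first.
  exact: pq.
move=> x; rewrite /root; have [->|x0] := eqVneq x 0.
  by rewrite !rev_poly_horner0.
rewrite !rev_poly_horner// !mulf_eq0 expf_eq0 (negPf x0) andbF /=.
exact: pq.
Qed.

Lemma pencil_map_rev d p q z : pencil d p q ->
  pencil_map d (rev_poly d p) (rev_poly d q) z = pencil_map d p q (sphere_inv z).
Proof.
case=> sp sq pq pqd; case: z => [z|] /=; last by rewrite !rev_poly_coefd.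
case: eqVneq => [->|z0] /=; first by rewrite !rev_poly_horner0.
by rewrite !rev_poly_horner// point_of_ratio_scale// expf_neq0.
Qed.

(** If [p = c q] then [q] has no root, hence is constant, and the coefficients
    of degree [d > 0] of both polynomials vanish. *)
Lemma pencil_neq0 d p q c : (0 < d)%N -> pencil d p q -> p - c *: q != 0.
Proof.
move=> d0 [sp sq pq pqd]; apply: contraFneq pqd => /subr0_eq pE.
have sq1 : (size q <= 1)%N.
  rewrite leqNgt; apply/negP => sq1.
  have /closed_rootP[x qx] : size q != 1 by rewrite neq_ltn sq1 orbT.
  by have := pq x; rewrite qx pE /root !hornerE (rootP qx) mulr0 eqxx.
by rewrite pE coefZ nth_default ?mulr0 ?eqxx// (leq_trans sq1).
Qed.

Lemma pencil_fiber_finite d p q w : (0 < d)%N -> pencil d p q ->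
  finite_set (pencil_map d p q @^-1` [set w]).
Proof.
move=> d0 pq; wlog [a ->] : p q w pq / exists a, w = Some a.
  move=> H; case: w => [a|]; first by apply: H => //; exists a.
  have := H q p (Some 0) (pencil_swap pq) (ex_intro _ _ erefl).
  apply: sub_finite_set => z /= zw.
  by rewrite (pencil_map_swap _ pq) zw.
have [s sE] := closed_field_poly_normal (p - a *: q).
have G0 := pencil_neq0 a d0 pq.
apply: (@sub_finite_set _ _ [set` (None : S) :: [seq Some z | z <- s]]); last first.
  exact: finite_seq.
move=> [z|_] /=; last by rewrite inE.
rewrite /point_of_ratio; case: eqVneq => // qz [paq]; rewrite inE /=.
apply/mapP; exists z => //.
rewrite -root_prod_XsubC -(@rootZ _ _ (lead_coef (p - a *: q)))
  ?lead_coef_eq0//.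
by rewrite -sE /root !hornerE -paq divfK// subrr.
Qed.

Lemma pencil_continuous_finite d p q (a : R[i]) : q.[a] != 0 ->
  {for (Some a : S), continuous (pencil_map d p q)}.
Proof.
move=> qa V; rewrite /= /point_of_ratio (negPf qa) => VV.
have near0 : \forall z \near (a : C), q.[z] != 0.
  have : nbhs (q.[a] : C) [set z | z != 0].
    apply/nbhs_ballP; exists `|q.[a]|; first by rewrite /= normr_gt0.
    by move=> z; rewrite -ball_normE/=; case: eqVneq => // ->; rewrite subr0 ltxx.
  exact: (@continuous_poly _ q a).
have cont : {for a, continuous (fun z : C => p.[z] / q.[z] : C)}.
  apply: (@continuousM R[i] C (horner p) (fun z => q.[z]^-1)).
    exact: continuous_poly.
  by apply: (@continuousV R[i] C (horner q)) => //; exact: continuous_poly.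
have nearV : \forall z \near (a : C), V (Some (p.[z] / q.[z])).
  exact: (cont (Some @^-1` V) VV).
apply: filterS2 near0 nearV => z /negPf qz Vz.
by rewrite /= /point_of_ratio qz.
Qed.

(** For [w] close to [w0 = p.[a] / q.[a]], the polynomial [p - w q] is small at
    [a] and bounded away from [0] at some fixed [b], so it has a root close to
    [a].  Such a root is a preimage of [w]. *)
Lemma pencil_open_finite d p q (a : R[i]) (V : set S) :
  (0 < d)%N -> pencil d p q -> q.[a] != 0 -> nbhs (Some a : S) V ->
  nbhs (pencil_map d p q (Some a)) (pencil_map d p q @` V).
Proof.
move=> d0 pq qa /nbhs_finiteP[r r0 rV]; rewrite /= /point_of_ratio (negPf qa).
set w0 := p.[a] / q.[a]; have [b Gb] := poly_nonroot (pencil_neq0 w0 d0 pq).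
set K := (1 + `|b - a| / r) ^+ d.
have K0 : 0 < K by rewrite exprn_gt0// ltr_pwDl// divr_ge0// ltW.
have D0 : 0 < `|q.[a]| * K + `|q.[b]|.
  by rewrite ltr_pwDl// mulr_gt0// normr_gt0.
(* With this radius, the hypothesis of [root_near] follows by the triangle
   inequality from the values of [p - w q], which are [(w0 - w) q.[a]] at
   [a] and [(p - w0 q).[b] + (w0 - w) q.[b]] at [b]. *)
apply/nbhs_finiteP; exists (`|(p - w0 *: q).[b]| / (`|q.[a]| * K + `|q.[b]|)).
  by rewrite divr_gt0// normr_gt0.
move=> w ww0; have [sp sq rpq _] := pq.
have [|//||x /rootP Gx xa] := @root_near _ (p - w *: q) d a b r.
- apply/leq_sizeP => j dj; rewrite coefB coefZ !nth_default ?mulr0 ?subr0//.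
  + exact: leq_trans dj.
  + exact: leq_trans dj.
- have -> : (p - w *: q).[a] = (w0 - w) * q.[a].
    by rewrite !hornerE mulrBl divfK.
  rewrite ltr_pdivlMr// mulrDr mulrA distrC in ww0.
  rewrite normrM -/K -mulrA; move: ww0; rewrite -ltrBrDr => ww0.
  rewrite mulrA; apply: lt_le_trans ww0 _.
  have -> : (p - w *: q).[b] = (p - w0 *: q).[b] + (w0 - w) * q.[b].
    by rewrite !hornerE mulrBl addrA subrK.
  by rewrite -normrM lerB_normD.
- exists (Some x); first exact: rV.
  have px : p.[x] = w * q.[x].
    by apply/eqP; rewrite -subr_eq0; move: Gx; rewrite !hornerE => ->.
  have qx : q.[x] != 0.
    apply/eqP => qx; have := rpq x.
    by rewrite /root px qx mulr0 eqxx.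
  by rewrite /= /point_of_ratio (negPf qx) px mulfK.
Qed.

(** Both the point and its value may be taken to be finite, by inversion at the
    source and at the target. *)
Lemma pencil_open d p q x (V : set S) :
  (0 < d)%N -> pencil d p q -> nbhs x V ->
  nbhs (pencil_map d p q x) (pencil_map d p q @` V).
Proof.
move=> d0; have fin p' q' a U : pencil d p' q' -> nbhs (Some a : S) U ->
    nbhs (pencil_map d p' q' (Some a)) (pencil_map d p' q' @` U).
  move=> pq aU; have [qa|qa] := eqVneq q'.[a] 0; last exact: pencil_open_finite.
  apply: nbhs_sphere_inv; rewrite -(pencil_map_swap _ pq).
  have pa : p'.[a] != 0.
    by case: pq => _ _ /(_ a); rewrite /root qa eqxx andbT => /negbT.
  have := pencil_open_finite d0 (pencil_swap pq) pa aU.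
  apply: filterS => _ [z Uz <-]; exists (pencil_map d p' q' z); first by exists z.
  by rewrite (pencil_map_swap _ pq).
move=> pq; case: x => [a|]; first exact: fin.
move=> VV; have := fin _ _ 0 (sphere_inv @^-1` V) (pencil_rev pq).
rewrite (pencil_map_rev _ pq) [sphere_inv _]/= eqxx.
have V0 : nbhs (Some 0 : S) (sphere_inv @^-1` V).
  by apply: (@sphere_inv_continuous _ (Some 0)); rewrite /= eqxx.
move=> /(_ V0); apply: filterS => _ [z Vz <-]; exists (sphere_inv z) => //.
by rewrite (pencil_map_rev _ pq).
Qed.

Lemma pencil_continuous d p q : pencil d p q -> continuous (pencil_map d p q).
Proof.
have fin p' q' a : pencil d p' q' ->
    {for (Some a : S), continuous (pencil_map d p' q')}.
  move=> pq; have [qa|qa] := eqVneq q'.[a] 0; last exact: pencil_continuous_finite.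
  have pa : p'.[a] != 0.
    by case: pq => _ _ /(_ a); rewrite /root qa eqxx andbT => /negbT.
  have -> : pencil_map d p' q' = sphere_inv \o pencil_map d q' p'.
    by apply/funext => z; rewrite /= (pencil_map_swap _ pq) sphere_invK.
  apply: continuous_comp; last exact: sphere_inv_continuous.
  exact: pencil_continuous_finite.
move=> pq [a|]; first exact: fin.
have -> : pencil_map d p q =
    pencil_map d (rev_poly d p) (rev_poly d q) \o sphere_inv.
  by apply/funext => z; rewrite /= (pencil_map_rev _ pq) sphere_invK.
apply: continuous_comp; first exact: sphere_inv_continuous.
exact: fin (pencil_rev pq).
Qed.

End pencil.

Section ratmap.
Context {R : realType} (f : ratmap R) (fdeg : (0 < ratmap_deg f)%N).
Local Notation S := (sphere R).
Local Notation d := (ratmap_deg f).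

(** Coprimality excludes common finite zeros.  At infinity, the two coefficients
    of degree [d] cannot vanish together, as [d] is the larger of the two
    degrees. *)
Lemma ratmap_pencil : pencil d (rnum f) (rden f).
Proof.
have dK : d.+1 = maxn (size (rnum f)) (size (rden f)).
  by move: fdeg; rewrite /d; case: maxn.
split; rewrite ?dK ?leq_maxl ?leq_maxr//.
  move=> x; apply/negP => /andP[px qx].
  by have := coprimep_root (rnum_rden_coprime f) px; rewrite (eqP qx) eqxx.
apply/negP => /andP[/eqP p0 /eqP q0].
have : (maxn (size (rnum f)) (size (rden f)) <= d)%N.
  rewrite geq_max; apply/andP; split; apply/leq_sizeP => j;
    rewrite leq_eqVlt => /predU1P[<-//|dj]; apply: nth_default;
    by apply: leq_trans dj; rewrite dK ?leq_maxl ?leq_maxr.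
by rewrite -dK ltnn.
Qed.

Lemma ratmapE : ratmap_fun f = pencil_map d (rnum f) (rden f).
Proof. by apply/funext => -[]. Qed.

Lemma ratmap_continuous : continuous f.
Proof. by rewrite ratmapE; exact: pencil_continuous ratmap_pencil. Qed.

Lemma ratmap_nbhs x V : nbhs x V -> nbhs (f x) (f @` V).
Proof. by rewrite ratmapE; exact: pencil_open ratmap_pencil. Qed.

Lemma ratmap_fiber_finite w : finite_set (f @^-1` [set w]).
Proof. by rewrite ratmapE; exact: pencil_fiber_finite ratmap_pencil. Qed.

End ratmap.

Lemma ratmap_two_preimages (R : realType) (f : ratmap R) :
  (1 < ratmap_deg f)%N ->
  exists B : seq (sphere R), forall w, w \notin B ->
    exists x y, [/\ x != y, f x = w & f y = w].
Proof.
move=> fdeg; have d2 : (2 < maxn (size (rnum f)) (size (rden f)))%N.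
  by move: fdeg; rewrite /ratmap_deg; case: maxn.
have [B BP] := pencil_two_roots (rnum_rden_coprime f) d2.
exists (None :: [seq Some c | c <- B]) => -[c|]; last by rewrite inE eqxx.
rewrite inE /= => cB; have [|x [y [xy Gx Gy]]] := BP c.
  by apply: contra cB => cB; apply/mapP; exists c.
have val z : root (rnum f - c *: rden f) z -> f (Some z) = Some c.
  move=> /rootP /eqP; rewrite !hornerE subr_eq0 => /eqP pz.
  have qz : (rden f).[z] != 0.
    apply/eqP => qz; have := coprimep_root (rnum_rden_coprime f) (x := z).
    by rewrite /root pz qz mulr0 eqxx => /(_ isT).
  by rewrite /= (negPf qz) pz mulfK.
by exists (Some x), (Some y); split; rewrite ?val//; apply: contra xy => /eqP[->].
Qed.

Local Close Scope complex_scope.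

(** * General topology *)

(** Near-covering compactness, applied to the filter of finite lists ordered by
    inclusion. *)
Lemma compact_finite_subcover (T : topologicalType) (K : set T)
    (B : T -> set T) : compact K -> (forall x, K x -> nbhs x (B x)) ->
  exists s : seq T, forall y, K y -> exists x, [/\ x \in s, K x & B x y].
Proof.
move=> /compact_near_coveringP cK BK.
pose F : set_system (seq T) :=
  [set A | exists s0 : seq T, forall s : seq T, {subset s0 <= s} -> A s].
have FF : Filter F.
  split; first by exists [::].
  - move=> P Q [s sP] [t tQ]; exists (s ++ t) => u stu.
    by split; [apply: sP|apply: tQ] => x xs; apply: stu; rewrite mem_cat xs ?orbT.
  - by move=> P Q PQ [s sP]; exists s => u /sP /PQ.
have [] := cK (seq T) F (fun s y => exists x, [/\ x \in s, K x & B x y]) FF.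
  move=> x Kx; exists (B x, [set s : seq T | x \in s]) => /=.
    split; first exact: BK.
    by exists [:: x] => s /(_ x); apply; exact: mem_head.
  by move=> [y s] /= [By xs]; exists x.
by move=> s /(_ s); move=> H; exists s => y Ky; exact: H.
Qed.

(** An injective open map has a continuous inverse on its image. *)
Lemma continuous_lift (X Y Z : topologicalType) (f : Y -> Z) (P : set Y)
    (g : X -> Z) (h : X -> Y) :
  (forall y V, nbhs y V -> nbhs (f y) (f @` V)) -> open P -> set_inj P f ->
  continuous g -> (forall x, P (h x)) -> (forall x, f (h x) = g x) ->
  continuous h.
Proof.
move=> fo oP fP gc hP fh x V Vx.
have PV : nbhs (h x) (V `&` P).
  by apply: filterI => //; exact: open_nbhs_nbhs.
have := fo _ _ PV; rewrite fh => /(gc x) near_x.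
have {}near_x : nbhs x (g @^-1` (f @` (V `&` P))) by [].
apply: filterS near_x => y [z [Vz Pz] fz].
by rewrite /= -(_ : z = h y)//; apply: fP; rewrite ?inE ?fh.
Qed.

(** Concatenation of paths. *)
Lemma path_component_trans (R : realType) (T : topologicalType) (A : set T)
    (x y z : T) :
  path_component R A x y -> path_component R A y z -> path_component R A x z.
Proof.
move=> [g [gc g0 g1 gA]] [h [hc h0 h1 hA]].
pose k (t : R) := if t <= 2^-1 then g (2 * t) else h (2 * t - 1).
have lin (a : R) : continuous (fun t : R => 2 * t - a).
  move=> t; apply: cvgB; last exact: cvg_cst.
  by apply: cvgM; [exact: cvg_cst|exact: cvg_id].
have within_comp (a b c : R) (p : R -> T) : {within `[0, 1], continuous p} ->
    (forall t, a <= t <= b -> 0 <= 2 * t - c <= 1) ->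
    (forall t, a <= t <= b -> k t = p (2 * t - c)) ->
    {within `[a, b], continuous k}.
  move=> pc sub kp; apply/subspace_continuousP => t tab.
  have /subspace_continuousP/(_ (2 * t - c)) := pc.
  rewrite /= in_itv/= in tab; rewrite /= in_itv/= sub// => /(_ isT) pt V VV.
  have /pt : nbhs (p (2 * t - c)) V by rewrite -(kp _ tab).
  rewrite /within /= => pV.
  have {}pV : nbhs t ((fun t => 2 * t - c) @^-1`
      [set u | `[0, 1]%classic u -> (p @^-1` V) u]).
    exact: lin.
  apply: filterS pV => u /= puV.
  rewrite in_itv => uab; rewrite /from_subspace/= kp//.
  by apply: puV; rewrite in_itv /= sub.
exists k; split.
- have -> : `[0, 1]%classic = `[0, 2^-1]%classic `|` `[(2^-1 : R), 1]%classic.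
    apply/seteqP; split => t /=; rewrite !in_itv/=.
      move=> /andP[t0 t1]; rewrite t0 t1 andbT/=.
      by have [?|/ltW ?] := leP t 2^-1; [left|right].
    by case=> /andP[t0 t1]; apply/andP; split; lra.
  apply: withinU_continuous; [exact: itv_closed|exact: itv_closed| |].
  + apply: (within_comp _ _ 0 g) => // t /andP[t0 t1].
      by apply/andP; split; lra.
    by rewrite /k t1 subr0.
  + apply: (within_comp _ _ 1 h) => // t /andP[t0 t1].
      by apply/andP; split; lra.
    rewrite /k; case: ifPn => // tge.
    have -> : t = 2^-1 by apply/eqP; rewrite eq_le tge.
    by rewrite divff// subrr h0 g1.
- by rewrite /k mulr0 invr_ge0 ler0n.
- rewrite /k leNgt invf_lt1 ?ltr1n//= mulr1.
  by rewrite -[X in X - _]/(1 + 1) addrK.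
- move=> t /andP[t0 t1]; rewrite /k; case: ifPn => tle.
    by apply: gA; apply/andP; split; lra.
  by apply: hA; rewrite -ltNge in tle; apply/andP; split; lra.
Qed.

(** * Backward orbits and leaves *)

Section dynamics.
Context {R : realType} (f : ratmap R) (fdeg : (0 < ratmap_deg f)%N).
Local Notation S := (sphere R).
Local Notation N := (natural_ext f).
Implicit Types (z w : N) (U V : set S).

Lemma natural_ext_inj z w : (forall n, orbit_proj n z = orbit_proj n w) -> z = w.
Proof. by move=> zw; apply: val_inj; apply/funext => n; exact: zw. Qed.

(** The topology of the inverse limit is induced by the product topology. *)
Lemma natural_ext_continuous (X : topologicalType) (g : X -> N) :
  (forall n, continuous (fun x => orbit_proj n (g x))) -> continuous g.
Proof.
move=> gc; apply: continuous_comp_initial => x.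
apply/cvg_sup => n V [_ [[W oW <-] Wx WV]].
have {}Wx : nbhs x ((fun y => orbit_proj n (g y)) @^-1` W).
  by apply: gc; exact: open_nbhs_nbhs.
by apply: filterS Wx => y /WV.
Qed.

Lemma orbit_proj_step z n : f (orbit_proj n.+1 z) = orbit_proj n z.
Proof. exact: (set_valP z). Qed.

Lemma orbit_proj_iterD z n k : iter k f (orbit_proj (k + n) z) = orbit_proj n z.
Proof.
by elim: k => [//|k IH]; rewrite iterSr addSn orbit_proj_step.
Qed.

Lemma iter_continuous n : continuous (iter n f : S -> S).
Proof.
elim: n => [|n IH] x; first exact: id.
have -> : (iter n.+1 f : S -> S) = f \o iter n f by apply/funext.
by apply: continuous_comp; [exact: IH|exact: ratmap_continuous].
Qed.

Lemma iter_nbhs n x V : nbhs x V -> nbhs (iter n f x) (iter n f @` V).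
Proof.
elim: n x V => [|n IH] x V xV; first by rewrite image_id.
have := ratmap_nbhs fdeg (IH _ _ xV).
apply: filterS => _ [_ [y Vy <-] <-]; by exists y.
Qed.

Lemma iter_fiber_finite n (w : S) : finite_set (iter n f @^-1` [set w]).
Proof.
elim: n w => [|n IH] w; first exact: finite_set1.
have -> : iter n.+1 f @^-1` [set w] =
    \bigcup_(y in f @^-1` [set w]) (iter n f @^-1` [set y]).
  apply/seteqP; split=> [x /= fx|x [y /= fy /= fx]].
    by exists (iter n f x).
  by rewrite fx.
by apply: bigcup_finite => //; exact: ratmap_fiber_finite.
Qed.

Lemma preimage_open (n : nat) U : open U -> open (iter n f @^-1` U).
Proof. by apply: open_comp => x _; exact: iter_continuous. Qed.

Lemma pullback_open n U z : open U -> open (pullback U z n).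
Proof. by move=> oU; apply: connected_component_open; exact: preimage_open. Qed.

Lemma pullback_refl n U z : U (orbit_proj 0 z) -> pullback U z n (orbit_proj n z).
Proof. by move=> Uz; exact: orbit_box_refl. Qed.

Lemma open_image V : open V -> open (f @` V).
Proof.
move=> oV; rewrite openE => _ [x Vx <-].
by apply: (ratmap_nbhs fdeg); exact: open_nbhs_nbhs.
Qed.

(** The image is open in [pullback U z n] since [f] is open.  It is also closed
    there: a limit of images is the image of a point of the closure of
    [pullback U z n.+1] by compactness, and this point lies in
    [pullback U z n.+1], because components are relatively closed. *)
Lemma pullback_image n U z : open U -> U (orbit_proj 0 z) ->
  f @` pullback U z n.+1 = pullback U z n.
Proof.
move=> oU Uz.
have sub : f @` pullback U z n.+1 `<=` pullback U z n.
  apply: connected_component_max.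
  - exists (orbit_proj n.+1 z); last exact: orbit_proj_step.
    exact: pullback_refl.
  - move=> _ [x /connected_component_sub xU <-].
    by move: xU; rewrite /= -iterS iterSr.
  - apply: connected_continuous_connected; first exact: component_connected.
    by apply: continuous_subspaceT; exact: ratmap_continuous.
apply: (@component_connected _ (iter n f @^-1` U) (orbit_proj n z)).
- by exists (f (orbit_proj n.+1 z)), (orbit_proj n.+1 z) => //; exact: pullback_refl.
- exists (f @` pullback U z n.+1); first exact/open_image/pullback_open.
  by apply/esym/setIidPr.
exists (f @` closure (pullback U z n.+1)).
  apply: compact_closed; first exact: sphere_hausdorff.
  apply: continuous_compact.
    by apply: continuous_subspaceT; exact: ratmap_continuous.
  apply: subclosed_compact sphere_compact _ => //; exact: closed_closure.
apply/seteqP; split => [x [y yP <-]|x [xP [y yP yx]]].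
  split; first by apply: sub; exists y.
  by exists y => //; exact: subset_closure.
exists y => //.
have Uy : (iter n.+1 f @^-1` U) y.
  by rewrite /= -iterS iterSr yx; exact: connected_component_sub xP.
have oy := @connected_component_open _ _ y (@preimage_open n.+1 U oU).
have [t [tP ty]] := yP _ (open_nbhs_nbhs (conj oy (connected_component_refl Uy))).
apply: (connected_component_trans tP); exact: connected_component_sym.
Qed.

Lemma pullback_iter n k U z (x : S) : open U -> U (orbit_proj 0 z) ->
  pullback U z (k + n) x -> pullback U z n (iter k f x).
Proof.
move=> oU Uz; elim: k x => [//|k IH] x; rewrite addSn iterSr => xP.
by apply: IH; rewrite -pullback_image//; exists x.
Qed.

(** From index [M] on, [f] restricts to homeomorphisms
    [pullback U z n.+1 -> pullback U z n]; the path is pulled back by their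
    inverses. *)
Lemma lift_path z U M (g : R -> S) : open U -> U (orbit_proj 0 z) ->
  (forall n, (M <= n)%N -> set_inj (pullback U z n.+1) f) ->
  continuous g -> g 0 = orbit_proj M z -> (forall t, pullback U z M (g t)) ->
  exists G : R -> N, [/\ continuous G, G 0 = z,
    forall t, orbit_proj M (G t) = g t & forall t, orbit_box U z (G t)].
Proof.
move=> oU Uz inj gc g0 gP.
have hex (my : nat * S) : exists x, pullback U z my.1 my.2 ->
    pullback U z my.1.+1 x /\ f x = my.2.
  have [|nP] := pselect (pullback U z my.1 my.2); last by exists None => /nP.
  by rewrite -pullback_image// => -[x xP fx]; exists x => _; split.
have [h hP] := choice hex.
pose L := fix L m (t : R) : S :=
  if m is m'.+1 then h ((M + m')%N, L m' t) else g t.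
have LP m t : pullback U z (M + m) (L m t).
  elim: m => [|m IH]; first by rewrite addn0.
  by rewrite addnS; case: (hP (_, _) IH).
have Lf m t : f (L m.+1 t) = L m t by case: (hP (_, _) (LP m t)).
have Lc m : continuous (L m).
  elim: m => [//|m IH].
  apply: (@continuous_lift _ _ _ f (pullback U z (M + m).+1) (L m)) => //.
  - by move=> *; exact: ratmap_nbhs.
  - exact: pullback_open.
  - by apply: inj; rewrite leq_addr.
  - by move=> t; rewrite -addnS.
have L0 m : L m 0 = orbit_proj (M + m) z.
  elim: m => [|m IH]; first by rewrite addn0.
  apply: (inj (M + m)%N); rewrite ?leq_addr ?inE// -?addnS//.
    exact: pullback_refl.
  by rewrite Lf IH addnS orbit_proj_step.
(* With truncated subtraction, one formula covers both the indices below
   [M], where the path is pushed forward by iterates of [f], and those above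
   [M], where it is pulled back. *)
pose W t n := iter (M - n) f (L (n - M)%N t).
have WB t : backward_orbit f (W t).
  move=> n; rewrite /W; have [Mn|nM] := leqP M n.
    by rewrite (eqP (leqW Mn)) (eqP Mn) subSn//= Lf.
  by rewrite -iterS -subSn// subSS (eqP (ltnW nM)) (eqP nM).
have MnE n : (M + (n - M) = (M - n) + n)%N by rewrite -maxnE maxnC maxnE addnC.
pose G t : N := exist _ (W t) (mem_set (WB t)).
have GE n t : orbit_proj n (G t) = W t n by [].
exists G; split.
- apply: natural_ext_continuous => n t.
  apply: (@continuous_comp _ _ _ (L (n - M)%N) (iter (M - n) f)).
    exact: Lc.
  exact: iter_continuous.
- by apply: natural_ext_inj => n; rewrite GE /W L0 MnE orbit_proj_iterD.
- by move=> t; rewrite GE /W subnn.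
- by move=> t n; rewrite GE; apply: pullback_iter; rewrite // -MnE.
Qed.

Lemma leaf_regular (L : set N) z : leaf L -> L z -> regular_points z.
Proof. by move=> [w _ ->] [g [_ _ <-]]; apply; rewrite ler01 lexx. Qed.

Lemma leaf_path (L : set N) z (G : R -> N) : leaf L -> L z ->
  continuous G -> G 0 = z -> (forall t, regular_points (G t)) -> L (G 1).
Proof.
move=> [w _ ->] zL Gc G0 Gr; apply: path_component_trans zL _.
by exists G; split => //; exact: continuous_subspaceT.
Qed.

Lemma eventually_univalentP U z : eventually_univalent U z ->
  exists M, forall n, (M <= n)%N -> set_inj (pullback U z n.+1) f.
Proof. by move=> [M _ MP]; exists M => n Mn; exact: MP. Qed.

(** Points near [orbit_proj n z] are images by [f^M0] of points near
    [orbit_proj (M0 + n) z], which are joined to it by small paths, and these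
    paths lift. *)
Lemma leaf_proj_open (L : set N) n : leaf L -> open (orbit_proj n @` L).
Proof.
move=> leafL; rewrite openE => _ [z Lz <-].
have [U [[oU Uz] uU]] := leaf_regular leafL Lz.
have [M0 M0P] := eventually_univalentP uU; pose M := (M0 + n)%N.
have MP k : (M <= k)%N -> set_inj (pullback U z k.+1) f.
  by move=> Mk; apply: M0P; apply: leq_trans Mk; rewrite leq_addr.
have Pz : nbhs (orbit_proj M z) (pullback U z M).
  by apply: open_nbhs_nbhs; split; [exact: pullback_open|exact: pullback_refl].
have [W Wz WP] := small_paths Pz.
have := iter_nbhs M0 Wz; rewrite orbit_proj_iterD.
apply: filterS => _ [y /WP[g [gc g0 g1 gU]] <-].
have [G [Gc G0 GM Gbox]] := lift_path oU Uz MP gc g0 gU.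
exists (G 1); last by rewrite -(orbit_proj_iterD (G 1) n M0) GM g1.
apply: (leaf_path leafL Lz Gc G0) => t; exists U; split.
  split=> //; have := Gbox t 0%N; exact: connected_component_sub.
apply: filterS uU => k; by rewrite (orbit_box_pullback _ (Gbox t)).
Qed.

(** As [f^n] has finite fibres, [orbit_proj n z] has a neighbourhood [O] inside
    [V] whose boundary contains no point of its fibre.  The complement [U] of
    the image of this boundary is a neighbourhood of [orbit_proj 0 z], and its
    pullback, connected and disjoint from the boundary, cannot leave [O]. *)
Lemma pullback_shrink z n V : nbhs (orbit_proj n z) V ->
  exists U, open_nbhs (orbit_proj 0 z) U /\ pullback U z n `<=` V.
Proof.
move=> zV; set zn := orbit_proj n z; set z0 := orbit_proj 0 z.
pose E := iter n f @^-1` [set z0] `\ zn.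
have closedE : closed E.
  apply: (accessible_finite_set_closed.1 (hausdorff_accessible sphere_hausdorff)).
  by apply: sub_finite_set (@iter_fiber_finite n z0) => x [].
have zVE : nbhs zn (V `&` ~` E).
  apply: filterI => //; apply: open_nbhs_nbhs; split; first exact: closed_openC.
  by move=> [_]; exact.
have [V' V'z V'V] :=
  compact_regular sphere_hausdorff sphere_compact filterT zVE.
pose O := V'°; pose D := closure V' `\` O.
have cD : compact D.
  apply: subclosed_compact sphere_compact _ => //.
  by apply: closedI; [exact: closed_closure|exact/open_closedC/open_interior].
have cfD : closed (iter n f @` D).
  apply: compact_closed; first exact: sphere_hausdorff.
  apply: continuous_compact => //.
  by apply: continuous_subspaceT; exact: iter_continuous.
exists (~` (iter n f @` D)).
have z0D : ~ (iter n f @` D) z0.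
  move=> [x [xV' xO] fx]; have [_ nE] := V'V _ xV'.
  have xz : x = zn by apply: contrapT => xz; apply: nE; split.
  by apply: xO; rewrite xz.
split; first by split => //; exact: closed_openC.
set P := pullback _ _ _; suff PO : P `&` O = P.
  by rewrite -PO => x [_ /interior_subset/subset_closure/V'V[]].
apply: (@component_connected _ (iter n f @^-1` (~` (iter n f @` D))) zn).
- by exists zn; split => //; exact: pullback_refl.
- by exists O => //; exact: open_interior.
- exists (closure V'); first exact: closed_closure.
  apply/seteqP; split => x [Px xO]; split => //.
    by apply: subset_closure; exact: interior_subset xO.
  apply: contrapT => nxO; apply: (connected_component_sub Px).
  by exists x.
Qed.

Lemma orbit_proj_leaf_continuous n :
  continuous (fun z : leaf_space f => orbit_proj n (leaf_space_val z)).
Proof.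
move=> z V zV; have [U1 [[oU1 U1z] U1V]] := pullback_shrink zV.
have [U0 [[oU0 U0z] uU0]] : regular_points (leaf_space_val z) by exact: set_valP.
exists (U0 `&` U1); last first.
  move=> w /= wU; apply: U1V; have := wU n.
  by apply: pullbackS => // x [].
split; first by split => //; exact: openI.
apply: filterS uU0 => k inj x y xP yP; apply: inj.
  by move: xP; rewrite !inE; apply: pullbackS => // ? [].
by move: yP; rewrite !inE; apply: pullbackS => // ? [].
Qed.

(** The image is open, and compact, hence closed, in the connected sphere. *)
Lemma leaf_proj_surj (L : set N) n : leaf L ->
  compact (@leaf_space_val R f @^-1` L) -> orbit_proj n @` L = setT.
Proof.
move=> leafL cL; apply: (@sphere_connected R).
- case: leafL => z0 rz ->; exists (orbit_proj n z0), z0 => //.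
  exists (fun=> z0); split=> //; exact/continuous_subspaceT/cst_continuous.
- exists (orbit_proj n @` L); last by rewrite setTI.
  exact: leaf_proj_open.
exists (orbit_proj n @` L); last by rewrite setTI.
have -> : orbit_proj n @` L =
    (fun z : leaf_space f => orbit_proj n (leaf_space_val z)) @`
      (@leaf_space_val R f @^-1` L).
  apply/seteqP; split => [_ [z Lz <-]|_ [z Lz <-]]; last by exists (leaf_space_val z).
  by exists (exist _ z (mem_set (leaf_regular leafL Lz))).
apply: compact_closed; first exact: sphere_hausdorff.
apply: continuous_compact => //; apply: continuous_subspaceT.
exact: orbit_proj_leaf_continuous.
Qed.

(** Univalence determines the coordinates of index greater than [M] from the
    one of index [M]; the other ones are its images. *)
Lemma orbit_box_proj_inj U z M :
  (forall n, (M <= n)%N -> set_inj (pullback U z n.+1) f) ->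
  {in orbit_box U z &, injective (@orbit_proj R f M)}.
Proof.
move=> inj v w /set_mem vU /set_mem wU vw; apply: natural_ext_inj => n.
have Mvw k : orbit_proj (M + k) v = orbit_proj (M + k) w.
  elim: k => [|k IH]; first by rewrite addn0.
  rewrite addnS; apply: (inj (M + k)%N); rewrite ?leq_addr ?inE//.
  by rewrite !orbit_proj_step.
by rewrite -(orbit_proj_iterD v n M) -(orbit_proj_iterD w n M) Mvw.
Qed.

(** Take [M] beyond the univalence indices of the finitely many boxes that cover
    [L].  Distinct points of a fibre of [orbit_proj M] then lie in different
    boxes. *)
Lemma compact_leaf_fiber (L : set N) : leaf L ->
  compact (@leaf_space_val R f @^-1` L) ->
  exists M k, forall (p : S) (s : seq N), uniq s ->
    (forall z, z \in s -> L z /\ orbit_proj M z = p) -> (size s <= k)%N.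
Proof.
move=> leafL cL.
have chooseU (z : leaf_space f) : exists UM : set S * nat,
    regular_nbhs (leaf_space_val z) UM.1 /\ forall n, (UM.2 <= n)%N ->
    set_inj (pullback UM.1 (leaf_space_val z) n.+1) f.
  have [U Uz] : regular_points (leaf_space_val z) by exact: set_valP.
  by have [M MP] := eventually_univalentP Uz.2; exists (U, M).
have [UM UMP] := choice chooseU.
pose box (x : leaf_space f) := orbit_box (UM x).1 (leaf_space_val x).
have [|r rP] := compact_finite_subcover
  (B := fun x => @leaf_space_val R f @^-1` box x) cL.
  by move=> z _; exists (UM z).1 => //; case: (UMP z).
pose M := \max_(x <- r) (UM x).2.
exists M, (size r) => p s us sP.
have hP z : exists x, z \in s -> x \in r /\ box x z.
  have [zs|] := boolP (z \in s); last first.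
    by move=> _; case: (leafL) => y ry _; exists (exist _ y (mem_set ry)).
  have [Lz _] := sP _ zs.
  have [x [xr _ xz]] := rP (exist _ z (mem_set (leaf_regular leafL Lz))) Lz.
  by exists x.
have [h hP'] := choice hP.
rewrite -(size_map h); apply: uniq_leq_size; last first.
  by move=> _ /mapP[z zs ->]; have [] := hP' z zs.
rewrite map_inj_in_uniq// => v w vs ws hvw.
have [xr vx] := hP' v vs; have [_ wx] := hP' w ws.
apply: (@orbit_box_proj_inj (UM (h v)).1 (leaf_space_val (h v)) M).
- move=> n Mn; apply: (UMP (h v)).2; apply: leq_trans Mn.
  exact: (@leq_bigmax_seq _ r predT (fun x => (UM x).2) (h v) xr).
- exact/mem_set.
- by apply/mem_set; rewrite hvw.
- by rewrite (sP v vs).2 (sP w ws).2.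
Qed.

End dynamics.

(** * Fibres of iterates *)

(** By induction, each of the [2^n] preimages of [w] by [f^n] has two preimages
    by [f], provided that [w] is not the image by [f^n] of one of the finitely
    many points that [ratmap_two_preimages] excludes. *)
Lemma many_iterated_preimages (R : realType) (f : ratmap R) :
  (1 < ratmap_deg f)%N ->
  forall n, exists B : seq (sphere R), forall w, w \notin B ->
    exists s : seq (sphere R), [/\ uniq s, size s = (2 ^ n)%N &
      forall x, x \in s -> iter n f x = w].
Proof.
move=> fdeg; have [B BP] := ratmap_two_preimages fdeg.
have two w : exists xy : sphere R * sphere R,
    w \notin B -> [/\ xy.1 != xy.2, f xy.1 = w & f xy.2 = w].
  have [/BP[x [y xyP]]|] := boolP (w \notin B); first by exists (x, y).
  by exists (None, None).
have [h hP] := choice two.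
elim=> [|n [Bn BnP]].
  by exists [::] => w _; exists [:: w]; split => // x; rewrite inE => /eqP.
exists (Bn ++ map (iter n f) B) => w; rewrite mem_cat negb_or.
move=> /andP[/BnP[s [us ss sP]] wB].
have sB x : x \in s -> x \notin B.
  by move=> xs; apply: contra wB => xB; rewrite -(sP x xs); exact: map_f.
exists (map (fun x => (h x).1) s ++ map (fun x => (h x).2) s); split.
- rewrite cat_uniq !map_inj_in_uniq ?us ?andbT/=.
  + apply/hasPn => _ /mapP[x xs ->]; apply/mapP => -[y ys e].
    have [_ _ x2] := hP x (sB x xs); have [yy y1 _] := hP y (sB y ys).
    have xy : x = y by rewrite -x2 e y1.
    by move: yy; rewrite -e xy eqxx.
  + by move=> x y /sB/hP[_ _ x2] /sB/hP[_ _ y2] e; rewrite -x2 e y2.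
  + by move=> x y /sB/hP[_ x1 _] /sB/hP[_ y1 _] e; rewrite -x1 e y1.
- by rewrite size_cat !size_map ss addnn -mul2n expnS.
- move=> y; rewrite mem_cat iterSr => /orP[] /mapP[x xs ->];
    have [_ x1 x2] := hP x (sB x xs); by rewrite ?x1 ?x2 sP.
Qed.

Lemma sphere_notin (R : realType) (B : seq (sphere R)) : exists p, p \notin B.
Proof.
apply: contrapT => nB.
pose s : seq (sphere R) := [seq Some (i%:R) | i <- iota 0 (size B).+1].
have us : uniq s.
  rewrite map_inj_uniq ?iota_uniq// => i j [] /eqP.
  by rewrite eqr_nat => /eqP.
have := uniq_leq_size us (s2 := B); rewrite size_map size_iota ltnn.
suff sB : {subset s <= B} by move=> /(_ sB).
by move=> x _; apply: contra_notT nB => xB; exists x.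
Qed.

(** * Leaves are not compact *)

Theorem lemma3p4 (R : realType) (f : ratmap R) (hdeg : (1 < ratmap_deg f)%N) :
  ~ exists L : set (natural_ext f),
      leaf L /\ compact (@leaf_space_val R f @^-1` L).
Proof.
move=> [L [leafL cL]]; have fdeg : (0 < ratmap_deg f)%N by exact: ltnW.
have [M [k MkP]] := compact_leaf_fiber leafL cL.
have [B BP] := many_iterated_preimages hdeg k.
have [p /BP[s [us ss sP]]] := sphere_notin B.
have lift q : exists z, L z /\ orbit_proj (k + M) z = q.
  have : [set: sphere R] q by [].
  by rewrite -(leaf_proj_surj fdeg (k + M) leafL cL) => -[z Lz <-]; exists z.
have [h hP] := choice lift.
have : (size (map h s) <= k)%N.
  apply: (MkP p).
    by rewrite map_inj_uniq// => x y e; rewrite -(hP x).2 e (hP y).2.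
  move=> _ /mapP[x xs ->]; split; first exact: (hP x).1.
  by rewrite -(orbit_proj_iterD _ M k) (hP x).2 sP.
by rewrite size_map ss leqNgt ltn_expl.
Qed.
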